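(* A linear operator $T:\mathbb C[z]\to\mathbb C[z]$ preserves stability (i.e. $T(\mathcal H_1(\mathbb C))\subseteq\mathcal H_1(\mathbb C)\cup\{0\}$) if and only if either (a) $T$ has range of dimension at most one and $T(f)=\alpha(f)P$ for $f\in\mathbb C[z]$, where $\alpha:\mathbb C[z]\to\mathbb C$ is a linear functional and $P\in\mathcal H_1(\mathbb C)$; or (b) $G_T(z,w)\in\overline{\mathcal H}_2(\mathbb C)$.
   Context: A polynomial in $k$ variables is stable if it is non-zero and does not vanish when all variables have positive imaginary part; $\mathcal H_k(\mathbb C)$ is the set of these and $\overline{\mathcal H}_k(\mathbb C)$ is the set of entire functions in $k$ variables that are limits, uniformly on compact subsets of $\mathbb C^k$, of polynomials in $\mathcal H_k(\mathbb C)$. For a linear operator $T$ on $\mathbb C[z]$, $G_T(z,w)=\sum_{n=0}^\infty\frac{(-1)^nT(z^n)}{n!}w^n\in\mathbb C[z][[w]]$; membership in $\overline{\mathcal H}_2(\mathbb C)$ means this series defines such an entire function. *)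

(* Defs.v *)
From HB Require Import structures.
From mathcomp Require Import all_boot all_order all_algebra.
From mathcomp Require Import complex.
From mathcomp Require Import reals.
Set Implicit Arguments. Unset Strict Implicit. Unset Printing Implicit Defensive.
Import Order.TTheory GRing.Theory Num.Theory.
Local Open Scope ring_scope.

Section Defs.
Variable R : realType.
Local Notation C := (R[i]).

Definition stable1 (p : {poly C}) : Prop :=
  p != 0 /\ forall z : C, 0 < 'Im z -> p.[z] != 0.

(* Bivariate polynomials in C[z,w] represented as {poly {poly C}}:
   inner variable z, outer variable w. *)
Definition eval2 (P : {poly {poly C}}) (z w : C) : C :=
  (map_poly (fun q : {poly C} => q.[z]) P).[w].

Definition stable2 (P : {poly {poly C}}) : Prop :=
  P != 0 /\ forall z w : C, 0 < 'Im z -> 0 < 'Im w -> eval2 P z w != 0.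

(* Closure of H_2: functions C^2 -> C that are limits, uniformly on compact
   subsets of C^2 (equivalently on every closed polydisk), of stable
   bivariate polynomials. *)
Definition closure_H2 (F : C -> C -> C) : Prop :=
  exists Ps : nat -> {poly {poly C}},
    (forall n, stable2 (Ps n)) /\
    forall r eps : C, 0 < r -> 0 < eps ->
      exists N : nat, forall n : nat, (N <= n)%N ->
        forall z w : C, `|z| <= r -> `|w| <= r ->
          `|eval2 (Ps n) z w - F z w| < eps.

Definition GT_partial (T : {poly C} -> {poly C}) (N : nat) (z w : C) : C :=
  \sum_(n < N) (-1) ^+ n * (T 'X^n).[z] * w ^+ n / (n`!)%:R.

Definition GT_in_closure_H2 (T : {poly C} -> {poly C}) : Prop :=
  exists F : C -> C -> C, closure_H2 F /\
    forall z w : C, forall eps : C, 0 < eps ->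
      exists N0 : nat, forall N : nat, (N0 <= N)%N ->
        `|GT_partial T N z w - F z w| < eps.

End Defs.

(* Main.v *)
Require Import Defs.
From HB Require Import structures.
From mathcomp Require Import all_boot all_order all_algebra.
From mathcomp Require Import all_solvable separable cyclotomic.
From mathcomp Require Import complex.
From mathcomp Require Import ring lra zify.
From mathcomp Require Import boolp classical_sets reals sequences exp.
Set Implicit Arguments. Unset Strict Implicit. Unset Printing Implicit Defensive.
Import Order.TTheory GRing.Theory Num.Theory.
Local Open Scope ring_scope.

(* A nonzero polynomial p has no zero in the upper half-plane iff |p(x + iy)| is nondecreasing
   in y > 0: a zero would propagate down a segment. This monotonicity survives pointwise
   limits, so it replaces Hurwitz' theorem.

   If G_T is a limit of stable P_m and f is stable, then (T f)(z) = f(-d/dw) G_T(z, w) at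
   w = 0 is the limit of the same expression for P_m; each factor -(d/dw + a) with Im a < 0
   preserves stability in w because Im (u'/u) <= 0, and f(z + i e) reduces to strict roots.

   Conversely let T preserve stability. If T((z + v)^n) = 0 for some Im v > 0, then, (z + v)^n
   + e g being stable for small e, T g is stable or 0 for all g of degree at most n; if this
   happens for unboundedly many n, two elements of the range are always proportional, as
   otherwise a combination vanishes at i. If not, T((1 - z w / n)^n) is stable for large n,
   and it converges to G_T: Szasz' inequality and Cauchy's estimate bound its coefficients in
   w on a line Im z = r, and monotonicity of |T(z^k)| extends the bound to |z| <= r. *)

(** Applies the composite of the operators [-(d/dw + a)], that is [f(-d/dw)] for the monic [f] with
    root list [s]. The ring is left general because the coefficients are taken both in the field and
    in polynomials in [z]. *)
Definition deriv_sum (A : nzRingType) (s : seq A) (u : {poly A}) :=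
  foldl (fun q a => - (q^`() + a *: q)) u s.

Lemma map_deriv_sum (A B : comNzRingType) (h : {rmorphism A -> B}) s u :
  map_poly h (deriv_sum s u) = deriv_sum [seq h a | a <- s] (map_poly h u).
Proof.
elim: s u => [|a s IH] u //=; rewrite /deriv_sum /= in IH *.
by rewrite IH rmorphN rmorphD /= map_polyZ deriv_map.
Qed.

(** * Polynomials without zeros in the upper half-plane *)

Section ClosedField.
Variable C : numClosedFieldType.
Implicit Types (p q u f g : {poly C}) (z w v : C).

Definition nonvanishing p := forall z, 0 < 'Im z -> p.[z] != 0.

Lemma Im_gt0_i : 0 < 'Im ('i : C). Proof. by rewrite Im_i ltr01. Qed.

Lemma nonvanishing_neq0 p : nonvanishing p -> p != 0.
Proof.
by move=> /(_ 'i Im_gt0_i); apply: contraNneq => ->; rewrite horner0.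
Qed.

Lemma nonvanishing_factor p : nonvanishing p ->
  exists2 s : seq C, p = lead_coef p *: \prod_(a <- s) ('X - a%:P)
    & forall a, a \in s -> 'Im a <= 0.
Proof.
move=> hp; have [s ps] := closed_field_poly_normal p; exists s => // a sa.
rewrite real_leNgt ?Creal_Im ?real0 //; apply/negP => /hp /negP; apply.
by rewrite ps -rootE rootZ ?lead_coef_eq0 ?nonvanishing_neq0 // root_prod_XsubC.
Qed.

(** With [x], [y], [b] the imaginary parts of [z], [z'], [a], the squared moduli differ by
    [(x - y)(x + y - 2b)], and both factors are nonnegative. *)
Lemma norm_sub_mono z' z a : 'Re z' = 'Re z -> `|'Im z'| <= 'Im z ->
  'Im a <= 0 -> `|z' - a| <= `|z - a|.
Proof.
move=> hre him ha; rewrite -ler_sqr ?nnegrE ?normr_ge0 // !normC2_Re_Im.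
rewrite !raddfB /= hre lerD2l -subr_ge0 subr_sqr.
have := him; rewrite real_ler_norml ?Creal_Im // => /andP[h1 h2].
set x := 'Im z in h1 h2 *; set y := 'Im z' in h1 h2 *; set b := 'Im a in ha *.
have -> : x - b - (y - b) = x - y by ring.
have -> : x - b + (y - b) = (y - - x) - b *+ 2 by ring.
by rewrite mulr_ge0 ?subr_ge0 // (le_trans (mulrn_wle0 2 ha)) // subr_ge0.
Qed.

(** Compare the linear factors one by one. Since [z'] may lie below the real axis, a bound on a
    horizontal line controls the whole strip down to its mirror image. *)
Lemma nonvanishing_mono p z' z : nonvanishing p -> 'Re z' = 'Re z ->
  `|'Im z'| <= 'Im z -> `|p.[z']| <= `|p.[z]|.
Proof.
move=> /nonvanishing_factor[s -> hs] hre him.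
rewrite !hornerZ !normrM ler_wpM2l ?normr_ge0 // !horner_prod !normr_prod.
rewrite !big_seq; apply: ler_prod => a sa; rewrite normr_ge0 !hornerXsubC /=.
exact: norm_sub_mono (hs _ sa).
Qed.

Lemma mono_nonvanishing p :
  (forall z t, 0 <= t -> t < 'Im z -> `|p.[z - 'i * t]| <= `|p.[z]|) ->
  p != 0 -> nonvanishing p.
Proof.
move=> hp p0 z hz; apply/negP => /eqP pz.
(* The denominator [k.+2] keeps every [rt k] strictly above the real axis; these are [size p]
   distinct roots, too many for a nonzero [p]. *)
pose rt (k : nat) := z - 'i * ('Im z / k.+2%:R).
suff: p = 0 by move/eqP; rewrite (negPf p0).
apply: (@roots_geq_poly_eq0 _ _ [seq rt k | k <- iota 0 (size p)]).
- apply/allP => _ /mapP[k _ ->]; rewrite rootE -normr_le0.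
  have <- : `|p.[z]| = 0 by rewrite pz normr0.
  apply: hp.
    by rewrite divr_ge0 ?ltW // ltr0n.
  by rewrite ltr_pdivrMr ?ltr0n // ltr_pMr // ltr1n.
- rewrite map_inj_uniq ?iota_uniq // => j k /addrI/oppr_inj.
  move/(mulfI (neq0Ci _))/(mulfI (lt0r_neq0 hz))/invr_inj/eqP.
  by rewrite eqr_nat => /eqP[].
- by rewrite size_map size_iota.
Qed.

(* Logarithmic derivative: Im (u'/u) <= 0 on the upper half-plane. *)
Lemma nonvanishing_deriv u w : nonvanishing u -> 0 < 'Im w ->
  exists2 d, 'Im d <= 0 & u^`().[w] = d * u.[w].
Proof.
move=> /nonvanishing_factor[s -> hs] hw; rewrite derivZ !hornerZ.
suff [d hd e] : exists2 d, 'Im d <= 0 & (\prod_(a <- s) ('X - a%:P))^`().[w]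
    = d * (\prod_(a <- s) ('X - a%:P)).[w].
  by exists d => //; rewrite e mulrCA.
elim: s hs => [|a s IH] hs.
  by exists 0; rewrite ?raddf0 // big_nil derivC horner0 mul0r.
have [b sb|d hd IHd] := IH; first by apply: hs; rewrite in_cons sb orbT.
have ha : 'Im a <= 0 by apply: hs; rewrite in_cons eqxx.
have hwa : 0 < 'Im (w - a).
  by rewrite raddfB /= subr_gt0 (le_lt_trans ha).
have wa0 : w - a != 0 by apply: contraTneq hwa => ->; rewrite raddf0 ltxx.
(* The witness is the sum of [(w - a)^-1] over the roots; inversion reverses the sign of the
   imaginary part. *)
exists ((w - a)^-1 + d).
  rewrite raddfD /= ImV (le_trans _ hd) // gerDr mulNr oppr_le0 divr_ge0 ?ltW //.
  by rewrite exprn_gt0 ?normr_gt0.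
rewrite big_cons derivM derivXsubC mul1r hornerD !hornerM IHd hornerXsubC.
by rewrite [RHS]mulrDl mulKf // mulrCA.
Qed.

(** At each point [u' + a u = (d + a) u] with ['Im d <= 0]; strictness of ['Im a < 0] excludes
    [d + a = 0]. *)
Lemma nonvanishing_deriv_add u a : 'Im a < 0 -> nonvanishing u ->
  nonvanishing (- (u^`() + a *: u)).
Proof.
move=> ha hu w hw; have [d hd e] := nonvanishing_deriv hu hw.
rewrite hornerN oppr_eq0 hornerD hornerZ e -mulrDl mulf_neq0 ?hu //.
have : 'Im (d + a) < 0 by rewrite raddfD /= -[ltRHS]addr0 ler_ltD.
by apply: contraTneq => ->; rewrite raddf0 ltxx.
Qed.

(* [pairing f u] is [f(-d/dw) u] at [w = 0]. *)
Definition pairing f u := \sum_(k < size f) f`_k * ((-1) ^+ k * k`!%:R * u`_k).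

Lemma pairing_wide n f u : (size f <= n)%N ->
  pairing f u = \sum_(k < n) f`_k * ((-1) ^+ k * k`!%:R * u`_k).
Proof.
move=> hn; rewrite /pairing.
rewrite (big_ord_widen n (fun k => f`_k * ((-1) ^+ k * k`!%:R * u`_k))) //.
rewrite big_mkcond; apply: eq_bigr => k _; case: ltnP => // hk.
by rewrite nth_default // mul0r.
Qed.

(** An index shift: [(k+1)! u_(k+1) = k! (u')_k], so multiplying [f] by [X] is adjoint to [-d/dw] on
    [u]. *)
Lemma pairingXsubC f u a :
  pairing (f * ('X - a%:P)) u = pairing f (- (u^`() + a *: u)).
Proof.
have hs : (size (f * ('X - a%:P))%R <= (size f).+1)%N.
  by apply: leq_trans (size_polyMleq _ _) _; rewrite size_XsubC addn2.
rewrite (pairing_wide _ hs) (@pairing_wide (size f).+1 f) //.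
have E k : (f * ('X - a%:P))`_k = (if k == 0%N then 0 else f`_k.-1) - a * f`_k.
  by rewrite mulrBr coefB coefMX coefMC mulrC.
rewrite (eq_bigr (fun k : 'I__ =>
   (if k == 0%N :> nat then 0 else f`_k.-1) * ((-1) ^+ k * k`!%:R * u`_k)
   - a * f`_k * ((-1) ^+ k * k`!%:R * u`_k))); last first.
  by move=> k _; rewrite E mulrBl.
rewrite big_split /= big_ord_recl /= mul0r add0r.
rewrite [X in _ = X](eq_bigr (fun k : 'I__ =>
   f`_k * ((-1) ^+ k.+1 * k.+1`!%:R * u`_k.+1)
   + - (a * f`_k * ((-1) ^+ k * k`!%:R * u`_k)))); last first.
  move=> k _; rewrite coefN coefD coefZ coef_deriv -mulr_natr factS natrM.
  rewrite exprS; ring.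
rewrite big_split /= [X in _ = X + _]big_ord_recr /=.
by rewrite nth_default // mul0r addr0.
Qed.

Lemma pairing_prod (s : seq C) c u :
  pairing (c *: \prod_(a <- s) ('X - a%:P)) u = c * (deriv_sum s u).[0].
Proof.
elim: s u => [|a s IH] u /=; last first.
  by rewrite big_cons mulrC scalerAl pairingXsubC IH.
rewrite big_nil (@pairing_wide 1).
  by rewrite big_ord1 coefZ coef1 mulr1 fact0 !mul1r horner_coef0.
by rewrite (leq_trans (size_scale_leq _ _)) ?size_poly1.
Qed.

Lemma nonvanishing_deriv_sum (s : seq C) u : (forall a, a \in s -> 'Im a < 0) ->
  nonvanishing u -> nonvanishing (deriv_sum s u).
Proof.
elim: s u => [|a s IH] u //= hs hu; apply: IH.
  by move=> b sb; apply: hs; rewrite in_cons sb orbT.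
by apply: nonvanishing_deriv_add => //; apply: hs; rewrite in_cons eqxx.
Qed.

Lemma norm_horner_le p r z : `|z| <= r ->
  `|p.[z]| <= \sum_(i < size p) `|p`_i| * r ^+ i.
Proof.
move=> hz; rewrite horner_coef; apply: le_trans (ler_norm_sum _ _ _) _.
apply: ler_sum => i _; rewrite normrM normrX ler_wpM2l ?normr_ge0 //.
by rewrite lerXn2r ?nnegrE ?normr_ge0 // (le_trans _ hz) ?normr_ge0.
Qed.

Lemma horner_lipschitz0 p : exists2 K : C, 0 <= K &
  forall x, `|x| <= 1 -> `|p.[x] - p.[0]| <= K * `|x|.
Proof.
elim/poly_ind: p => [|p c _].
  by exists 0 => // x _; rewrite !horner0 subrr normr0 mul0r.
exists (\sum_(i < size p) `|p`_i| * 1 ^+ i).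
  by apply: sumr_ge0 => i _; rewrite expr1n mulr1 normr_ge0.
move=> x hx; rewrite !hornerMXaddC mulr0 add0r addrK normrM.
by rewrite ler_wpM2r ?normr_ge0 // norm_horner_le.
Qed.

Lemma norm_horner0_mono p q c :
  (forall e, 0 < e -> `|p.[c * e]| <= `|q.[c * e]|) -> `|p.[0]| <= `|q.[0]|.
Proof.
move=> h; have [K K0 hK] := horner_lipschitz0 p.
have [L L0 hL] := horner_lipschitz0 q.
apply/ler_addgt0Pr => e e0.
have D0 : 0 < (K + L + e) * (`|c| + 1).
  by rewrite mulr_gt0 ?ltr_wpDl ?addr_ge0 ?normr_ge0 ?ltr01.
(* Chosen so that [|c d| (K + L + e) <= e], which also gives [|c d| <= 1]; the summands [e] and [1]
   keep the denominator positive when the constants or [c] vanish. *)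
pose d := e / ((K + L + e) * (`|c| + 1)).
have d0 : 0 < d by rewrite divr_gt0.
have cd : `|c * d| = `|c| * d by rewrite normrM (gtr0_norm d0).
have cd1 : `|c| * d * (K + L + e) <= e.
  rewrite /d invfM mulrCA -mulrA -[leRHS]mulr1 ler_wpM2l ?(ltW e0) //.
  have KLe : 0 < K + L + e by rewrite ltr_wpDl ?addr_ge0.
  rewrite -mulrA [_ * (K + L + e)]mulrAC mulVf ?gt_eqF // mul1r.
  by rewrite ler_pdivrMr ?mul1r ?lerDl ?ler01 // ltr_wpDl ?normr_ge0 ?ltr01.
have cd2 : `|c * d| <= 1.
  have KLe : 0 < K + L + e by rewrite ltr_wpDl ?addr_ge0.
  rewrite cd -(ler_pM2r KLe) mul1r (le_trans cd1) // lerDr addr_ge0 //.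
have h1 : `|p.[0]| <= `|p.[c * d]| + K * `|c * d|.
  rewrite -[X in `|X| <= _](subrK p.[c * d]) addrC.
  by rewrite (le_trans (ler_normD _ _)) // lerD2l distrC hK.
have h2 : `|q.[c * d]| <= `|q.[0]| + L * `|c * d|.
  rewrite -[X in `|X| <= _](subrK q.[0]) addrC.
  by rewrite (le_trans (ler_normD _ _)) // lerD2l hL.
apply: le_trans h1 _; apply: le_trans (lerD (h _ d0) (lexx _)) _.
apply: le_trans (lerD h2 (lexx _)) _; rewrite -addrA lerD2l -mulrDl.
rewrite cd mulrC (le_trans _ cd1) // ler_wpM2l //.
  by rewrite mulr_ge0 ?normr_ge0 // ltW.
by rewrite [L + K]addrC lerDl ltW.
Qed.

Definition eval_inner z (P : {poly {poly C}}) : {poly C} :=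
  map_poly (fun q : {poly C} => q.[z]) P.

Lemma horner_eval_inner z w P : (eval_inner z P).[w] = P.[w%:P].[z].
Proof.
rewrite /eval_inner -[in LHS](hornerC w z) (horner_map (horner_eval z)) //.
Qed.

Lemma eval_inner_deriv_sum z (s : seq C) P :
  eval_inner z (deriv_sum [seq a%:P | a <- s] P) = deriv_sum s (eval_inner z P).
Proof.
rewrite /eval_inner (map_deriv_sum (horner_eval z)) -map_comp.
congr deriv_sum; rewrite -[RHS]map_id; apply: eq_map => a /=.
by rewrite /horner_eval hornerC.
Qed.

(** The pairing is the value at [w = 0] of [deriv_sum s] applied in [w]. For fixed [w = i e] this is
    a polynomial in [z] without zeros in the upper half-plane, hence has monotone modulus; then [e]
    tends to 0. *)
Lemma pairing_mono P (s : seq C) c z z' :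
  (forall z w, 0 < 'Im z -> 0 < 'Im w -> (eval_inner z P).[w] != 0) ->
  (forall a, a \in s -> 'Im a < 0) ->
  0 < 'Im z -> 0 < 'Im z' -> 'Re z' = 'Re z -> 'Im z' <= 'Im z ->
  `|pairing (c *: \prod_(a <- s) ('X - a%:P)) (eval_inner z' P)|
    <= `|pairing (c *: \prod_(a <- s) ('X - a%:P)) (eval_inner z P)|.
Proof.
move=> hP hs hz hz' hre him.
rewrite !pairing_prod !normrM ler_wpM2l ?normr_ge0 //.
apply: (@norm_horner0_mono _ _ 'i) => e e0.
have hie : 0 < 'Im ('i * e) by rewrite ImMil (Creal_ReP _ _) ?gtr0_real.
rewrite -!eval_inner_deriv_sum !horner_eval_inner.
apply: nonvanishing_mono => //; last by rewrite gtr0_norm.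
move=> v hv; rewrite -horner_eval_inner eval_inner_deriv_sum.
by apply: nonvanishing_deriv_sum => // w hw; apply: hP.
Qed.
End ClosedField.

(** * Cauchy's estimate and Szasz' inequality *)

Section CoefficientBounds.
Variable C : numClosedFieldType.
Implicit Types (p q u f g : {poly C}) (z w : C).

Lemma prim_root_exists n : (0 < n)%N -> exists z : C, n.-primitive_root z.
Proof.
pose p : {poly C} := 'X^n - 1; have [r Dp] := closed_field_poly_normal p.
move=> n_gt0; rewrite (monicP _) ?monicXnsubC // scale1r in Dp.
have rn1 : all n.-unity_root r.
  by apply/allP=> z; rewrite -root_prod_XsubC -Dp.
have sz_r : (n < (size r).+1)%N.
  by rewrite -(size_prod_XsubC r id) -Dp size_XnsubC.
have [|z] := hasP (has_prim_root n_gt0 rn1 _ sz_r); last by exists z.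
by rewrite -separable_prod_XsubC -Dp separable_Xn_sub_1 // pnatr_eq0 -lt0n.
Qed.

Lemma sum_expr_unity n (x : C) : x ^+ n = 1 ->
  \sum_(j < n) x ^+ j = if x == 1 then n%:R else 0.
Proof.
move=> xn; case: eqVneq => [->|x1].
  by rewrite (eq_bigr (fun=> 1)) ?sumr_const ?card_ord // => j _; rewrite expr1n.
have /eqP := subrX1 x n; rewrite xn subrr eq_sym mulf_eq0 subr_eq0 (negPf x1).
by move=> /eqP.
Qed.

(* Cauchy's estimate, by averaging over roots of unity. *)
Lemma norm_coef_le p r B k : 0 <= r ->
  (forall z, `|z| = r -> `|p.[z]| <= B) -> `|p`_k| * r ^+ k <= B.
Proof.
move=> r0 hB.
have B0 : 0 <= B by apply: le_trans (hB r _); rewrite ?normr_ge0 ?ger0_norm.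
(* As [n] exceeds both [k] and the degree, [i + (n - k)] with [i < n] is a multiple of [n] only for
   [i = k]; the factor [x ^+ (j * (n - k))] stands for [x^(-jk)]. *)
pose n := maxn (size p) k.+1; have n0 : (0 < n)%N by rewrite leq_max orbT.
have hkn : (k < n)%N by rewrite leq_max leqnn orbT.
have [x hx] := prim_root_exists n0; have xn := prim_expr_order hx.
have nx : `|x| = 1.
  by apply/eqP; rewrite -(@pexpr_eq1 _ _ n) ?normr_ge0 // -normrX xn normr1.
have E : \sum_(j < n) p.[r * x ^+ j] * x ^+ (j * (n - k)) = n%:R * (p`_k * r ^+ k).
  transitivity (\sum_(i < n) p`_i * r ^+ i * \sum_(j < n) (x ^+ (i + (n - k))) ^+ j).
    under eq_bigr => j _.
      rewrite (@horner_coef_wide _ n) ?leq_maxl // big_distrl /=.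
      under eq_bigr => i _.
        rewrite exprMn -!exprM mulrA -mulrA -exprD -mulnDr mulnC.
        rewrite exprM; over.
      over.
    by rewrite exchange_big /=; apply: eq_bigr => i _; rewrite big_distrr.
  have A (i : 'I_n) : \sum_(j < n) (x ^+ (i + (n - k))) ^+ j
     = if i == Ordinal hkn then n%:R else 0.
    rewrite sum_expr_unity; last by rewrite -exprM mulnC exprM xn expr1n.
    rewrite -(prim_order_dvd hx) -val_eqE /=; congr (if _ then _ else _).
    have hi := ltn_ord i; apply/idP/eqP => [|->]; last by rewrite subnKC // ltnW.
    rewrite addnBA ?(ltnW hkn) //.
    move=> /dvdnP[[|[|d]]]; lia.
  under eq_bigr => i _ do rewrite A.
  rewrite (bigD1 (Ordinal hkn)) //= eqxx big1 ?addr0 1?mulrC //.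
  by move=> i /negPf ->; rewrite mulr0.
have n0' : 0 < n%:R :> C by rewrite ltr0n.
rewrite -(ler_pM2l n0') -[X in X * _]normr_nat -[r ^+ k]ger0_norm ?exprn_ge0 //.
rewrite -!normrM -E; apply: le_trans (ler_norm_sum _ _ _) _.
apply: le_trans (_ : _ <= \sum_(j < n) B) _; last first.
  by rewrite sumr_const card_ord mulr_natl.
apply: ler_sum => j _; rewrite normrM normrX nx expr1n mulr1 hB //.
by rewrite normrM normrX nx expr1n mulr1 ger0_norm.
Qed.

(** Newton's identities: the first two power sums depend only on the coefficients of degree 1 and
    2. *)
Lemma coef_prod_1DZ (s : seq C) : let p := \prod_(a <- s) (1 + a *: 'X) in
  [/\ p`_0 = 1, p`_1 = \sum_(a <- s) a
    & \sum_(a <- s) a ^+ 2 = p`_1 ^+ 2 - 2 * p`_2].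
Proof.
elim: s => [|a s /= [IH0 IH1 IH2]] /=; first by rewrite !big_nil !coef1 /=; split=> //; ring.
rewrite !big_cons mulrDl mul1r -scalerAl !coefD !coefZ !coefXM /= IH0 IH1 IH2.
by split; rewrite ?IH1; ring.
Qed.

Lemma normC2D z w : `|z + w| ^+ 2 = `|z| ^+ 2 + 2 * 'Re (z * w^*) + `|w| ^+ 2.
Proof.
rewrite !normC2_Re_Im ReM Re_conj Im_conj !raddfD /=; ring.
Qed.

(* Same-sign imaginary parts let the first two power sums control the sum of squared moduli. *)
Lemma sum_norm2_le (s : seq C) : (forall a, a \in s -> 'Im a <= 0) ->
  \sum_(a <- s) `|a| ^+ 2
    <= `|\sum_(a <- s) a ^+ 2| + 2 * `|\sum_(a <- s) a| ^+ 2.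
Proof.
move=> hs.
(* Termwise, [|a|^2 = Re (a^2) + 2 (Im a)^2]. *)
have -> : \sum_(a <- s) `|a| ^+ 2
    = 'Re (\sum_(a <- s) a ^+ 2) + 2 * \sum_(a <- s) 'Im a ^+ 2.
  rewrite raddf_sum /= mulr_sumr -big_split /=; apply: eq_bigr => a _.
  by rewrite normC2_Re_Im [a ^+ 2]expr2 ReM; ring.
apply: lerD.
  by rewrite (le_trans (real_ler_norm (Creal_Re _))) // (leif_normC_Re_Creal _).1.
rewrite ler_wpM2l ?ler0n // (@le_trans _ _ ((\sum_(a <- s) 'Im a) ^+ 2)) //.
  elim: s hs => [|a s IH] hs; first by rewrite !big_nil expr0n.
  rewrite !big_cons sqrrD -addrA lerD2l.
  have hs' b : b \in s -> 'Im b <= 0 by move=> sb; apply: hs; rewrite in_cons sb orbT.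
  rewrite (le_trans (IH hs')) // lerDr mulrn_wge0 // mulr_le0 ?hs ?mem_head //.
  by rewrite big_seq sumr_le0.
rewrite -raddf_sum normC2_Re_Im lerDr real_exprn_even_ge0 ?Creal_Re //.
Qed.
End CoefficientBounds.

Section Szasz.
Variable R : realType.
Local Notation C := R[i].
Implicit Types (z w : C).

(** From [1 + x <= exp x]; the bound depends on [S] alone and not on the number of factors. *)
Lemma prod1D_bounded (S : C) : exists2 B : C, 0 <= B &
  forall s : seq C, (forall x, x \in s -> -1 <= x) -> \sum_(x <- s) x <= S ->
    \prod_(x <- s) (1 + x) <= B.
Proof.
exists (expR (complex.Re S))%:C%C; first by rewrite ler0c expR_ge0.
move=> s hs hS; apply: (@le_trans _ _ (expR (complex.Re (\sum_(x <- s) x)))%:C%C); last first.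
  by rewrite lecR ler_expR; move: hS; rewrite lecE => /andP[].
elim: s hs {hS} => [|x s IH] hs; first by rewrite !big_nil expR0.
have {}IH : \prod_(y <- s) (1 + y) <= (expR (complex.Re (\sum_(y <- s) y)))%:C%C.
  by apply: IH => y sy; apply: hs; rewrite in_cons sy orbT.
have hx : 0 <= 1 + x by rewrite addrC -lerBlDr sub0r hs // mem_head.
rewrite !big_cons (_ : complex.Re (x + _) = complex.Re x + complex.Re (\sum_(j <- s) j)); last by case: x {hs hx} => a b; case: (\sum_(j <- s) j).
rewrite expRD rmorphM /= ler_pM //.
  rewrite big_seq; apply: prodr_ge0 => y sy.
  by rewrite addrC -lerBlDr sub0r hs // in_cons sy orbT.
have -> : 1 + x = (1 + complex.Re x)%:C%C.
  have xr : x \is Num.real by rewrite -[x](addKr 1) rpredD ?rpredN ?rpred1 ?ger0_real.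
  by rewrite rmorphD rmorph1 /= RRe_real.
by rewrite lecR expR_ge1Dx.
Qed.

(** Write [h / h_0] as a product of [1 + a X] with [a] the negated inverse roots, so [Im a <= 0].
    Then [|1 + a w|^2 - 1 = 2 Re (a w) + |a|^2 r^2] on [|w| = r], and the sums of [a] and [|a|^2]
    are controlled by the coefficients 1 and 2. The bound [B] is thus independent of the degree. *)
Lemma szasz (A1 A2 r : C) : 0 <= r -> exists2 B : C, 0 <= B &
  forall h : {poly C}, nonvanishing h -> h`_0 != 0 ->
    `|h`_1| <= A1 * `|h`_0| -> `|h`_2| <= A2 * `|h`_0| ->
    forall k, `|h`_k| * r ^+ k <= B * `|h`_0|.
Proof.
move=> r0.
(* Here [3 A1^2 + 2 A2] bounds [|p_1^2 - 2 p_2| + 2 |p_1|^2], hence the sum of the [|a|^2]. *)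
have [B B0 hB] := prod1D_bounded (2 * (A1 * r) + (3 * A1 ^+ 2 + 2 * A2) * r ^+ 2).
(* [B] bounds the squared modulus, and [B <= (1 + B)^2] avoids a square root. *)
exists (1 + B); first by rewrite addr_ge0 ?ler01.
move=> h hh h0 h1 h2 k; apply: norm_coef_le => // w hw.
have [s hs sI] := nonvanishing_factor hh.
pose t := [seq - a^-1 | a <- s]; pose p := \prod_(a <- t) (1 + a *: 'X) : {poly C}.
have s0 a : a \in s -> a != 0.
  move=> sa; apply: contraNneq h0 => a0; rewrite -horner_coef0 -[X in h.[X]]a0 hs -rootE.
  by rewrite rootZ ?lead_coef_eq0 ?nonvanishing_neq0 // root_prod_XsubC.
have tI b : b \in t -> 'Im b <= 0.
  move=> /mapP[a sa ->]; rewrite raddfN /= ImV mulNr opprK.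
  by rewrite mulr_le0_ge0 ?sI // invr_ge0 exprn_ge0.
have [p0 p1 p2] := coef_prod_1DZ t; rewrite -/p in p0 p1 p2.
have hp : h = h`_0 *: p.
  suff [c hc] : exists c, h = c *: p by rewrite hc coefZ p0 mulr1.
  exists (lead_coef h * \prod_(a <- s) (- a)); rewrite -scalerA {1}hs; congr (_ *: _).
  rewrite /p big_map -scaler_prod !big_seq; apply: eq_bigr => a sa.
  rewrite scalerDr scaleNr scalerA mulrNN mulfV ?s0 // scale1r addrC.
  by rewrite -scaleNr alg_polyC polyCN.
have {}h1 : `|p`_1| <= A1.
  by move: h1; rewrite hp !coefZ p0 mulr1 normrM mulrC ler_pM2r ?normr_gt0.
have {}h2 : `|p`_2| <= A2.
  by move: h2; rewrite hp !coefZ p0 mulr1 normrM mulrC ler_pM2r ?normr_gt0.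
suff hpw : `|p.[w]| ^+ 2 <= B.
  rewrite hp hornerZ coefZ p0 mulr1 normrM mulrC ler_wpM2r //.
  rewrite -ler_sqr ?nnegrE ?normr_ge0 ?addr_ge0 ?ler01 // (le_trans hpw) //.
  rewrite sqrrD expr1n mul1r mulr2n -!addrA ler_wpDl ?ler01 // lerDl.
  by rewrite addr_ge0 ?exprn_ge0.
have -> : `|p.[w]| ^+ 2 = \prod_(x <- [seq `|1 + a * w| ^+ 2 - 1 | a <- t]) (1 + x).
  rewrite /p horner_prod normr_prod -prodrXl [RHS]big_map; apply: eq_bigr => a _.
  by rewrite hornerD hornerC hornerZ hornerX [RHS]addrC subrK.
apply: hB => [_ /mapP[a _ ->]|]; first by rewrite lerDr exprn_ge0.
rewrite big_map.
have -> : \sum_(a <- t) (`|1 + a * w| ^+ 2 - 1)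
    = 2 * 'Re (p`_1 * w) + (\sum_(a <- t) `|a| ^+ 2) * r ^+ 2.
  rewrite p1 [X in 'Re X]mulr_suml raddf_sum /= mulr_sumr mulr_suml -big_split /=.
  apply: eq_bigr => a _; rewrite normC2D normr1 normrM hw mul1r Re_conj; ring.
have A10 : 0 <= A1 by apply: le_trans h1.
apply: lerD.
  rewrite ler_wpM2l ?ler0n // (le_trans (real_ler_norm (Creal_Re _))) //.
  rewrite (le_trans (leif_normC_Re_Creal _).1) // normrM hw ler_wpM2r //.
rewrite ler_wpM2r ?exprn_ge0 // (le_trans (sum_norm2_le tI)) // -p1 p2.
have -> : 3 * A1 ^+ 2 + 2 * A2 = (A1 ^+ 2 + 2 * A2) + 2 * A1 ^+ 2 by ring.
have hp1 : `|p`_1| ^+ 2 <= A1 ^+ 2 by rewrite lerXn2r.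
rewrite lerD ?ler_wpM2l ?ler0n // (le_trans (ler_normB _ _)) //.
by rewrite normrX normrM normr_nat lerD // ler_wpM2l ?ler0n.
Qed.
End Szasz.

(** * Limits of complex sequences *)

Section Limits.
Variable R : realType.
Local Notation C := R[i].
Implicit Types (z w : C).

Lemma exists_ge_nat (x : C) : 0 <= x -> exists n : nat, x <= n%:R.
Proof.
move=> x0; exists (Num.bound (complex.Re x)).
have xr : (complex.Re x)%:C%C = x by rewrite RRe_real ?ger0_real.
rewrite -xr -(rmorph_nat (real_complex R)) /= lecR ltW // archi_boundP //.
by rewrite -ler0c xr.
Qed.

Lemma exists_div_exp2_le (M e : C) : 0 <= M -> 0 < e ->
  exists n0 : nat, forall n, (n0 <= n)%N -> M / 2 ^+ n <= e.
Proof.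
move=> M0 e0; have [n0 hn0] := exists_ge_nat (divr_ge0 M0 (ltW e0)).
exists n0 => n hn; rewrite ler_pdivrMr ?exprn_gt0 ?ltr0n // mulrC -ler_pdivrMr //.
rewrite (le_trans hn0) // -natrX ler_nat (leq_trans hn) //.
by rewrite ltnW // ltn_expl.
Qed.

Lemma geometric_tail (b : nat -> C) M n n' :
  (forall k, `|b k| <= M / 2 ^+ k) -> (n <= n')%N ->
  `|\sum_(k < n') b k - \sum_(k < n) b k| <= 2 * M / 2 ^+ n.
Proof.
move=> hb hn; have M0 : 0 <= M.
  by have := hb 0%N; rewrite expr0 divr1; apply: le_trans.
(* Subtracting the tail at [n'] gives a bound that passes through the induction on [n' - n]. *)
suff : `|\sum_(k < n') b k - \sum_(k < n) b k| <= 2 * M / 2 ^+ n - 2 * M / 2 ^+ n'.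
  move=> h; apply: (le_trans h); rewrite gerBl divr_ge0 ?exprn_ge0 ?mulr_ge0 ?ler0n //.
rewrite -(subnKC hn); elim: (n' - n)%N => [|d IH].
  by rewrite addn0 !subrr normr0.
rewrite addnS big_ord_recr /= addrAC; apply: le_trans (ler_normD _ _) _.
apply: le_trans (lerD IH (hb _)) _.
have -> : 2 * M / 2 ^+ (n + d).+1 = M / 2 ^+ (n + d) :> C.
  by rewrite exprS invfM; field; rewrite expf_neq0 // pnatr_eq0.
by rewrite le_eqVlt; apply/orP; left; apply/eqP; field; rewrite !expf_neq0 // pnatr_eq0.
Qed.

(** Every [x m - d m] lies below every [x n + d n], so the supremum of the lower ends lies in all
    the intervals; this keeps the rate [d]. *)
Lemma cauchy_real_limit (x d : nat -> R) :
  (forall n n', (n <= n')%N -> `|x n' - x n| <= d n) ->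
  exists l, forall n, `|x n - l| <= d n.
Proof.
move=> hx; pose E := [set y | exists n, y = x n - d n]%classic.
have ubE n : ubound E (x n + d n).
  have d0 k : 0 <= d k by apply: le_trans (hx _ _ (leqnn k)); rewrite normr_ge0.
  move=> _ [m ->]; have := d0 n; have := d0 m; have [h|/ltnW h] := leqP n m.
    by have := hx _ _ h; rewrite ler_norml => /andP[]; lra.
  by have := hx _ _ h; rewrite ler_norml => /andP[]; lra.
have E0 : (E !=set0)%classic by exists (x 0%N - d 0%N), 0%N.
exists (sup E) => n; have h1 : sup E <= x n + d n by apply: ge_sup.
have h2 : x n - d n <= sup E.
  by apply: ub_le_sup; [exists (x 0%N + d 0%N) | exists n].
by rewrite ler_norml; apply/andP; split; lra.
Qed.

Lemma cauchy_limit (u : nat -> C) (d : nat -> R) :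
  (forall n n', (n <= n')%N -> `|u n' - u n| <= (d n)%:C%C) ->
  exists l, forall n, `|u n - l| <= 2 * (d n)%:C%C.
Proof.
move=> hu.
have [|x hx] := @cauchy_real_limit (fun n => complex.Re (u n)) d.
  move=> n n' h; rewrite -lecR; apply: le_trans (hu _ _ h).
  by apply: le_trans (normc_ge_Re _); case: (u n) (u n') => ? ? [].
have [|y hy] := @cauchy_real_limit (fun n => complex.Im (u n)) d.
  move=> n n' h; rewrite -lecR; apply: le_trans (hu _ _ h).
  rewrite -[leRHS]mulr1 -(normCi C) -normrM.
  apply: le_trans (normc_ge_Re _); case: (u n) (u n') => a b [a' b'] /=.
  by rewrite mulr0 mulr1 sub0r normrN.
exists (x +i* y)%C => n.
have -> : u n - (x +i* y)%C = (complex.Re (u n) - x)%:C%C + 'i * (complex.Im (u n) - y)%:C%C.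
  by rewrite -complexiE; case: (u n) => a b; simpc.
apply: le_trans (ler_normD _ _) _; rewrite normrM normCi mul1r mulr2n mulrDl mul1r.
have N (a : R) : `|a%:C%C| = `|a|%:C%C by rewrite normc_def /= expr0n addr0 sqrtr_sqr.
by rewrite !N lerD ?lecR.
Qed.

End Limits.

(** * Preservation of stability from the symbol *)

Section Symbol.
Variable R : realType.
Local Notation C := R[i].
Implicit Types (z w : C) (f p q : {poly C}).
Variable T : {linear {poly C} -> {poly C}}.

Definition symbol_coef z n : C := (-1) ^+ n * (T 'X^n).[z] / n`!%:R.

Lemma GT_partialE n z w :
  GT_partial T n z w = \sum_(k < n) symbol_coef z k * w ^+ k.
Proof. by apply: eq_bigr => k _; rewrite /symbol_coef mulrAC. Qed.

Lemma stable1P p : stable1 p <-> nonvanishing p.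
Proof. by split=> [[]|h] //; split=> //; apply: nonvanishing_neq0. Qed.

Lemma horner_linear f z : (T f).[z] = \sum_(k < size f) f`_k * (T 'X^k).[z].
Proof.
rewrite -{1}[f]coefK poly_def linear_sum /= horner_sum.
by apply: eq_bigr => k _; rewrite linearZ /= hornerZ.
Qed.

(** The weights [(-1)^k k!] of [pairing] cancel those of the symbol, so pairing [f] with the symbol
    coefficients at [z] gives exactly [(T f)(z)]. *)
Lemma sub_pairing_le f z (u : {poly C}) (e : C) : (forall k, `|u`_k - symbol_coef z k| <= e) ->
  `|pairing f u - (T f).[z]| <= (\sum_(k < size f) `|f`_k| * k`!%:R) * e.
Proof.
move=> hu; rewrite horner_linear /pairing -sumrB mulr_suml.
apply: le_trans (ler_norm_sum _ _ _) _; apply: ler_sum => k _.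
have -> : (T 'X^k).[z] = (-1) ^+ k * k`!%:R * symbol_coef z k.
  transitivity ((-1) ^+ k * (-1) ^+ k * (T 'X^k).[z] * (k`!%:R / k`!%:R)).
    by rewrite divff ?pnatr_eq0 -?lt0n ?fact_gt0 // mulr1 -expr2 sqrr_sign mul1r.
  by rewrite /symbol_coef; ring.
rewrite -!mulrBr !normrM normrX normrN1 expr1n mul1r normr_nat mulrA.
by rewrite ler_wpM2l // mulr_ge0 ?ler0n.
Qed.

Section Converse.
Variables (F : C -> C -> C) (P : nat -> {poly {poly C}}).
Hypothesis P_stable : forall n, stable2 (P n).
Hypothesis P_cvg : forall r eps : C, 0 < r -> 0 < eps ->
  exists N : nat, forall n : nat, (N <= n)%N ->
    forall z w : C, `|z| <= r -> `|w| <= r -> `|eval2 (P n) z w - F z w| < eps.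
Hypothesis GT_cvg : forall z w eps : C, 0 < eps ->
  exists N0 : nat, forall N : nat, (N0 <= N)%N ->
    `|GT_partial T N z w - F z w| < eps.

(** The terms of a series convergent at [w = 2] are bounded: late ones are differences of two
    partial sums within 1 of the limit, the finitely many early ones are summed into the
    constant. *)
Lemma symbol_coef_bounded z :
  exists M : C, forall k, `|symbol_coef z k| <= M / 2 ^+ k.
Proof.
have [n0 hn0] := GT_cvg z 2 ltr01.
exists (2 + \sum_(j < n0) `|symbol_coef z j| * 2 ^+ j) => k.
rewrite ler_pdivlMr ?exprn_gt0 ?ltr0n //.
have S0 (s : 'I_n0 -> bool) : 0 <= \sum_(j < n0 | s j) `|symbol_coef z j| * 2 ^+ j.
  by apply: sumr_ge0 => j _; rewrite mulr_ge0 ?exprn_ge0 ?ler0n.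
have [hk|hk] := leqP n0 k; last first.
  by rewrite (bigD1 (Ordinal hk)) //= addrCA lerDl addr_ge0 ?ler0n ?S0.
apply: ler_wpDr; first exact: (S0 xpredT).
have -> : `|symbol_coef z k| * 2 ^+ k
    = `|(GT_partial T k.+1 z 2 - F z 2) - (GT_partial T k z 2 - F z 2)|.
  rewrite opprB addrA subrK !GT_partialE big_ord_recr /= addrAC subrr add0r [RHS]normrM normrX.
  by rewrite normr_nat.
rewrite (le_trans (ler_normB _ _)) // -[leRHS]/(1 + 1).
by rewrite lerD // ltW // hn0 // leqW.
Qed.

(** Only pointwise convergence is assumed; the geometric decay of the coefficients makes the tails
    uniformly small on the unit circle. *)
Lemma GT_partial_uniform z (e : C) : 0 < e -> exists n0, forall n w,
  (n0 <= n)%N -> `|w| = 1 -> `|GT_partial T n z w - F z w| <= e.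
Proof.
move=> e0; have [M hM] := symbol_coef_bounded z.
have M0 : 0 <= M by have := hM 0%N; rewrite expr0 divr1; apply: le_trans.
have [n0 hn0] := @exists_div_exp2_le _ (2 * M) _ (mulr_ge0 (ler0n _ 2) M0) e0.
exists n0 => n w hn hw; apply/ler_addgt0Pr => d d0.
have [n1 hn1] := GT_cvg z w d0; pose n' := maxn n n1.
rewrite -(subrK (GT_partial T n' z w) (GT_partial T n z w)) -addrA.
apply: le_trans (ler_normD _ _) _; apply: lerD; last first.
  by rewrite ltW // hn1 // leq_maxr.
rewrite distrC; apply: le_trans (hn0 _ hn); rewrite !GT_partialE.
apply: (@geometric_tail _ (fun k => symbol_coef z k * w ^+ k)); last exact: leq_maxl.
by move=> k; rewrite normrM normrX hw expr1n mulr1.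
Qed.

(** Cauchy's estimate on the unit circle for the difference of [P m] and a partial sum longer than
    [k], both close to [F] there; hence uniformity in [k]. *)
Lemma eval_inner_coef_cvg z (e : C) : 0 < e -> exists m0, forall m, (m0 <= m)%N ->
  forall k, `|(eval_inner z (P m))`_k - symbol_coef z k| <= e.
Proof.
move=> e0; have e2 : 0 < e / 2 by rewrite divr_gt0 ?ltr0n.
have [n0 hn0] := GT_partial_uniform z e2.
have r0 : 0 < `|z| + 1 by rewrite ltr_wpDl ?ltr01.
have [m0 hm0] := P_cvg r0 e2; exists m0 => m hm k.
pose n := maxn n0 k.+1; pose S := \poly_(j < n) symbol_coef z j.
have Sk : S`_k = symbol_coef z k by rewrite coef_poly /n leq_max leqnn orbT.
rewrite -Sk -coefB -[X in X <= _]mulr1 -[X in _ * X <= _](expr1n C k).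
apply: norm_coef_le => // w hw; rewrite hornerD hornerN.
have -> : S.[w] = GT_partial T n z w by rewrite GT_partialE /S horner_poly.
rewrite -(subrK (F z w) (eval_inner z (P m)).[w]) -addrA [e]splitr.
apply: le_trans (ler_normD _ _) _; apply: lerD.
  by apply: ltW; apply: hm0; rewrite ?hw ?lerDl ?lerDr ?ler01.
by rewrite distrC hn0 // leq_maxl.
Qed.

Lemma horner_mono_strict (s : seq C) c z z' : (forall a, a \in s -> 'Im a < 0) ->
  0 < 'Im z -> 0 < 'Im z' -> 'Re z' = 'Re z -> 'Im z' <= 'Im z ->
  `|(T (c *: \prod_(a <- s) ('X - a%:P))).[z']|
    <= `|(T (c *: \prod_(a <- s) ('X - a%:P))).[z]|.
Proof.
move=> hs hz hz' hre him; set f := _ *: _; apply/ler_addgt0Pr => e e0.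
pose K := \sum_(k < size f) `|f`_k| * k`!%:R.
have K0 : 0 <= K by apply: sumr_ge0 => k _; rewrite mulr_ge0 ?ler0n.
have D0 : 0 < 2 * K + 1 by rewrite ltr_wpDl ?ltr01 ?mulr_ge0 ?ler0n.
(* Two pairings, at [z] and [z'], each contribute an error of at most [K] times this number. *)
have d0 : 0 < e / (2 * K + 1) by rewrite divr_gt0.
have [m0 hm0] := eval_inner_coef_cvg z d0.
have [m1 hm1] := eval_inner_coef_cvg z' d0.
pose m := maxn m0 m1.
have hm := sub_pairing_le f (hm0 m (leq_maxl _ _)).
have hm' := sub_pairing_le f (hm1 m (leq_maxr _ _)).
have hp : `|pairing f (eval_inner z' (P m))| <= `|pairing f (eval_inner z (P m))|.
  by apply: pairing_mono => //; case: (P_stable m).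
have tri (x y : C) : `|x| <= `|y| + `|x - y|.
  by rewrite -{1}(subrK y x) addrC ler_normD.
apply: le_trans (tri _ (pairing f (eval_inner z' (P m)))) _.
rewrite distrC; apply: le_trans (lerD hp hm') _.
apply: le_trans (lerD (tri _ (T f).[z]) (lexx _)) _.
apply: le_trans (lerD (lerD (lexx _) hm) (lexx _)) _.
rewrite -addrA lerD2l -/K -mulrDl mulrA ler_pdivrMr //.
rewrite mulrC ler_wpM2l ?(ltW e0) //.
by rewrite (_ : 2 * K + 1 = K + K + 1) ?lerDl ?ler01 //; ring.
Qed.

Lemma shift_taylor f c :
  f \Po ('X + c%:P) = \sum_(k < size f) c ^+ k *: f^`N(k).
Proof.
rewrite /comp_poly nderiv_taylor; last exact: mulrC.
rewrite size_map_polyC; apply: eq_bigr => k _.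
rewrite nderivn_map -[map_poly _ _]/((f^`N(k))^:P) -/(comp_poly 'X _) comp_polyXr.
by rewrite -polyC_exp mulrC mul_polyC.
Qed.

Lemma GT_preserves f : stable1 f -> stable1 (T f) \/ T f = 0.
Proof.
move=> /stable1P/nonvanishing_factor[s fs hs].
have [->|Tf0] := eqVneq (T f) 0; [by right|left; apply/stable1P].
apply: mono_nonvanishing => // z t t0 tz.
(* By Taylor's formula [(q v).[c]] is [T (f(X + c))] at [v], a polynomial in [c]. For [c = i e] the
   roots [a - i e] lie strictly below the real axis, so the strict case applies before [e] tends to
   0. *)
pose q z := \sum_(k < size f) (T f^`N(k)).[z] *: 'X^k : {poly C}.
have qE v c : (q v).[c] = (T (f \Po ('X + c%:P))).[v].
  rewrite shift_taylor linear_sum /= !horner_sum; apply: eq_bigr => k _.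
  by rewrite linearZ /= !hornerZ hornerXn mulrC.
have q0 v : (q v).[0] = (T f).[v] by rewrite qE addr0 comp_polyXr.
rewrite -!q0; apply: (@norm_horner0_mono _ _ _ 'i) => e e0.
have qie v : (q v).['i * e] = (T (lead_coef f *:
    \prod_(a <- [seq a - 'i * e | a <- s]) ('X - a%:P))).[v].
  rewrite qE {1}fs comp_polyZ rmorph_prod /= big_map; congr (T (_ *: _)).[_].
  apply: eq_bigr => a _; rewrite comp_polyB comp_polyX comp_polyC polyCB opprB.
  by rewrite addrA addrAC.
have tr : t \is Num.real by rewrite ger0_real.
rewrite !qie; apply: horner_mono_strict => //.
- move=> _ /mapP[a sa ->]; rewrite raddfB /= ImMil (Creal_ReP _ _) ?gtr0_real //.
  by rewrite subr_lt0 (le_lt_trans (hs _ sa)).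
- exact: le_lt_trans t0 tz.
- by rewrite raddfB /= ImMil (Creal_ReP _ tr) subr_gt0.
- by rewrite raddfB /= ReMil (Creal_ImP _ tr) oppr0 subr0.
- by rewrite raddfB /= ImMil (Creal_ReP _ tr) gerBl.
Qed.
End Converse.
End Symbol.

(** * Convergence of the symbol of a stability preserver *)

Section Perturbation.
Variable C : numClosedFieldType.
Implicit Types (z v : C) (g p : {poly C}).

Lemma Im_le_norm z : 'Im z <= `|z|.
Proof.
have := (leif_Re_Creal ('i * - z)).1.
by rewrite ReMil raddfN opprK normrM normCi mul1r normrN.
Qed.

Lemma nonvanishing_exp_shift v n : 0 < 'Im v -> nonvanishing (('X + v%:P) ^+ n).
Proof.
move=> hv z hz; rewrite horner_exp hornerD hornerX hornerC expf_neq0 //.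
have : 0 < 'Im (z + v) by rewrite raddfD addr_gt0.
by apply: contraTneq => ->; rewrite raddf0 ltxx.
Qed.

(** Expand [g] at [-v]: since [|z + v| >= Im v] on the upper half-plane and [g] has degree at most
    [n], [|g(z)| <= K |z + v|^n] there, and [e = 1 / (K + 1)] keeps the perturbation strictly
    smaller than the main term. *)
Lemma nonvanishing_perturb v n g : 0 < 'Im v -> (size g <= n.+1)%N ->
  exists2 e, e != 0 & nonvanishing (('X + v%:P) ^+ n + e *: g).
Proof.
move=> hv hg; pose y := 'Im v.
pose K := \sum_(k < n.+1) `|g^`N(k).[- v]| / y ^+ (n - k).
have K0 : 0 <= K by apply: sumr_ge0 => k _; rewrite divr_ge0 ?exprn_ge0 ?(ltW hv).
have K1 : 0 < K + 1 by rewrite ltr_wpDl ?ltr01.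
exists (K + 1)^-1; first by rewrite invr_neq0 ?gt_eqF.
move=> z hz; rewrite hornerD hornerZ horner_exp hornerD hornerX hornerC.
have him : y < 'Im (z + v) by rewrite raddfD ltrDr.
have hzv : y <= `|z + v|.
  by rewrite (le_trans (ltW him)) // Im_le_norm.
have zv0 : 0 < `|z + v| by apply: lt_le_trans hzv.
have hgz : `|g.[z]| <= K * `|z + v| ^+ n.
  rewrite -[z in g.[z]](addKr v) (nderiv_taylor_wide (n := n.+1)) //; last exact: mulrC.
  apply: le_trans (ler_norm_sum _ _ _) _; rewrite mulr_suml; apply: ler_sum => k _.
  rewrite normrM normrX -mulrA ler_wpM2l // mulrC [v + z]addrC.
  rewrite ler_pdivlMr ?exprn_gt0 // -[X in _ <= _ ^+ X](subnKC (ltn_ord k : (k <= n)%N)) exprD.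
  by rewrite ler_wpM2l ?exprn_ge0 // lerXn2r ?nnegrE ?(ltW hv) ?normr_ge0.
rewrite -normr_gt0 -[_ * g.[z]]opprK; apply: lt_le_trans (lerB_dist _ _).
rewrite subr_gt0 normrN normrM normfV (gtr0_norm K1) normrX.
rewrite mulrC ltr_pdivrMr // (le_lt_trans hgz) // mulrC ltr_pM2l ?exprn_gt0 //.
by rewrite ltrDl ltr01.
Qed.

(** Each factor satisfies [|z - a| >= Im z - Im a >= r]. *)
Lemma nonvanishing_lower_bound p (r : C) : nonvanishing p -> 0 < r ->
  exists2 d : C, 0 < d & forall z, 'Im z = r -> d <= `|p.[z]|.
Proof.
move=> hp r0; have [s ps hs] := nonvanishing_factor hp.
exists (`|lead_coef p| * r ^+ size s).
  by rewrite mulr_gt0 ?exprn_gt0 // normr_gt0 lead_coef_eq0 nonvanishing_neq0.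
move=> z hz; rewrite {2}ps hornerZ normrM ler_wpM2l // horner_prod normr_prod.
elim: s hs {ps} => [|a s IH] hs; first by rewrite !big_nil.
rewrite big_cons exprS ler_pM ?exprn_ge0 ?(ltW r0) //; last first.
  by apply: IH => b sb; apply: hs; rewrite in_cons sb orbT.
rewrite hornerXsubC (le_trans _ (Im_le_norm _)) // raddfB /= hz lerDl oppr_ge0.
by rewrite hs ?mem_head.
Qed.
End Perturbation.

(** * Weights comparing [(1 + t / n)^n] with the exponential series *)

Section Approximants.
Variable R : realType.
Local Notation C := R[i].
Implicit Types (z w : C) (f p q : {poly C}).

(** The ratio of the coefficient of [t^k] in [(1 + t / n)^n] to [1 / k!]. *)
Definition binomial_weight (n k : nat) : C := (n ^_ k)%:R / n%:R ^+ k.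

Lemma binomial_weight_ge0 n k : 0 <= binomial_weight n k.
Proof. by rewrite divr_ge0 ?exprn_ge0 ?ler0n. Qed.

Lemma binomial_weight_gt0 n k : (0 < n)%N -> (k <= n)%N -> 0 < binomial_weight n k.
Proof. by move=> n0 kn; rewrite divr_gt0 ?exprn_gt0 ?ltr0n ?ffact_gt0. Qed.

Lemma binomial_weightS n k : (0 < n)%N ->
  binomial_weight n k.+1 = binomial_weight n k * ((n - k)%:R / n%:R).
Proof.
move=> n0; rewrite /binomial_weight ffactnSr natrM exprSr invfM.
by rewrite [LHS]mulrACA.
Qed.

Lemma binomial_weight_leS n k : (0 < n)%N ->
  binomial_weight n k.+1 <= binomial_weight n k.
Proof.
move=> n0; rewrite binomial_weightS // ler_piMr ?binomial_weight_ge0 //.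
by rewrite ler_pdivrMr ?ltr0n // mul1r ler_nat leq_subr.
Qed.

Lemma binomial_weight_le1 n k : (0 < n)%N -> binomial_weight n k <= 1.
Proof.
move=> n0; elim: k => [|k IH]; first by rewrite /binomial_weight expr0 divr1.
by apply: le_trans (binomial_weight_leS _ n0) IH.
Qed.

(** Induction on [k]: each step loses at most [k / n <= 2^k / n]. The crude [2^k] is later absorbed
    by the decay of the symbol coefficients. *)
Lemma binomial_weight_sub1 n k : (0 < n)%N ->
  1 - binomial_weight n k <= 2 ^+ k / n%:R.
Proof.
move=> n0; elim: k => [|k IH].
  by rewrite /binomial_weight ffactn0 expr0 divr1 subrr divr_ge0 ?ler0n.
have n0' : 0 < n%:R :> C by rewrite ltr0n.
have h : 1 - k%:R / n%:R <= (n - k)%:R / n%:R :> C.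
  rewrite ler_pdivlMr // mulrBl mul1r divfK ?gt_eqF // lerBlDr -natrD ler_nat.
  by rewrite addnC -leq_subLR.
rewrite binomial_weightS //.
have -> : 2 ^+ k.+1 / n%:R = 2 ^+ k / n%:R + 2 ^+ k / n%:R :> C by rewrite exprS; ring.
apply: (@le_trans _ _ ((1 - binomial_weight n k) + binomial_weight n k * (k%:R / n%:R))).
  have := ler_wpM2l (binomial_weight_ge0 n k) h; rewrite -subr_ge0 => hc.
  rewrite -subr_ge0 (le_trans hc) // le_eqVlt; apply/orP; left; apply/eqP; ring.
rewrite lerD // -[leRHS]mul1r ler_pM ?binomial_weight_ge0 ?divr_ge0 ?ler0n //.
  exact: binomial_weight_le1.
by rewrite ler_pM2r ?invr_gt0 // -natrX ler_nat ltnW // ltn_expl.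
Qed.
End Approximants.

(** * Degenerate preservers, and stability of the approximants *)

Section Preserver.
Variable R : realType.
Local Notation C := R[i].
Implicit Types (z w v : C) (f g p q : {poly C}).
Variable T : {linear {poly C} -> {poly C}}.

(** Fix [g] with [T g] nonzero and let [alpha f = (T f)(i) / (T g)(i)]. Then [T (f - alpha f *: g)]
    vanishes at [i], so it must be 0. *)
Lemma rank_le1 : (forall f, T f = 0 \/ nonvanishing (T f)) ->
  exists (alpha : {linear {poly C} -> C^o}) P,
    stable1 P /\ forall f, T f = alpha f *: P.
Proof.
move=> hT; have [[g g0]|T0] := pselect (exists g, T g != 0); last first.
  exists (\0 : {linear {poly C} -> C^o}), 1; split.
    by apply/stable1P => z _; rewrite hornerC oner_neq0.
  move=> f; rewrite scale0r; apply/eqP/negPn/negP => f0; by apply: T0; exists f.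
have hg : nonvanishing (T g) by have [/eqP|//] := hT g; rewrite (negPf g0).
have gi : (T g).['i] != 0 by apply: hg; apply: Im_gt0_i.
pose a f : C^o := (T f).['i] / (T g).['i].
have a_lin : linear a.
  by move=> c p q; rewrite /a linearP /= hornerD hornerZ mulrDl -mulrA.
pose al : {linear {poly C} -> C^o} := HB.pack a (GRing.isLinear.Build _ _ _ _ a a_lin).
exists al, (T g); split; first exact/stable1P.
move=> f; apply/eqP; rewrite -subr_eq0 -linearZ -linearB.
have [-> //|/(_ 'i (Im_gt0_i _))] := hT (f - al f *: g).
by rewrite linearB linearZ /= hornerD hornerN hornerZ /a divfK // subrr eqxx.
Qed.

Hypothesis hT : forall f, stable1 f -> stable1 (T f) \/ T f = 0.

(** For [n] at least [size f], [(X + v)^n + e f] is stable for some nonzero [e], and [T] maps it to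
    [e T f]. *)
Lemma degenerate_rank_le1 :
  (forall N, exists n v, [/\ (N <= n)%N, 0 < 'Im v & T (('X + v%:P) ^+ n) = 0]) ->
  forall f, T f = 0 \/ nonvanishing (T f).
Proof.
move=> h f; have [n [v [hn hv T0]]] := h (size f).
have [e e0 /stable1P/hT] := @nonvanishing_perturb _ v n f hv (leqW hn).
rewrite linearD linearZ /= T0 add0r => -[/stable1P h1|/eqP].
  right=> z hz; have := h1 z hz; rewrite hornerZ mulf_eq0 negb_or => /andP[] //.
by rewrite scaler_eq0 (negPf e0) => /eqP; left.
Qed.

(** For [n > 0], [T] acting in [z] on [(1 - z w / n)^n], given by its coefficients in [w]. *)
Definition approximant n : {poly {poly C}} :=
  \poly_(k < n.+1) ((binomial_weight R n k * (-1) ^+ k / k`!%:R) *: T 'X^k).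

Lemma eval_inner_approximant n z :
  eval_inner z (approximant n)
  = \poly_(k < n.+1) (binomial_weight R n k * symbol_coef T z k).
Proof.
apply/polyP => k; rewrite /eval_inner coef_map_id0 ?horner0 // !coef_poly.
case: ifP => _; last by rewrite horner0.
by rewrite hornerZ /symbol_coef; ring.
Qed.

Lemma eval2_approximant n z w : eval2 (approximant n) z w
  = \sum_(k < n.+1) binomial_weight R n k * (symbol_coef T z k * w ^+ k).
Proof.
rewrite -[eval2 _ _ _]/((eval_inner z (approximant n)).[w]).
rewrite eval_inner_approximant horner_poly.
by apply: eq_bigr => k _; rewrite mulrA.
Qed.

Lemma eval2_approximantE n z w : (0 < n)%N ->
  eval2 (approximant n) z w = (T ((1 + (- (w / n%:R)) *: 'X) ^+ n)).[z].
Proof.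
move=> n0; rewrite eval2_approximant exprDn linear_sum horner_sum.
apply: eq_bigr => k _; rewrite expr1n mul1r exprZn -scaler_nat scalerA.
have TZ c p : T (c *: p) = c *: T p by rewrite linearZ.
rewrite TZ hornerZ.
have -> : 'C(n, k)%:R = (n ^_ k)%:R / k`!%:R :> C.
  by rewrite -bin_ffact natrM mulfK // pnatr_eq0 -lt0n fact_gt0.
have -> : (- (w / n%:R)) ^+ k = (-1) ^+ k * (w ^+ k / n%:R ^+ k).
  by rewrite [LHS]exprNn exprMn exprVn.
by rewrite /binomial_weight /symbol_coef; ring.
Qed.

(** With [a = - w / n], [1 + a X = a (X + a^-1)] and [Im a^-1 > 0]. So [T ((X + a^-1)^n)], nonzero
    by hypothesis, is stable. *)
Lemma approximant_neq0 N : (forall n v, (N <= n)%N -> 0 < 'Im v ->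
    T (('X + v%:P) ^+ n) != 0) ->
  forall n, (0 < n)%N -> (N <= n)%N ->
  forall z w, 0 < 'Im z -> 0 < 'Im w -> eval2 (approximant n) z w != 0.
Proof.
move=> hN n n0 Nn z w hz hw; rewrite eval2_approximantE //.
have nR : n%:R != 0 :> C by rewrite pnatr_eq0 -lt0n.
have w0 : w != 0 by apply: contraTneq hw => ->; rewrite raddf0 ltxx.
set a := - (w / n%:R).
have a0 : a != 0 by rewrite oppr_eq0 mulf_neq0 ?invr_neq0.
have -> : 1 + a *: 'X = a *: ('X + (a^-1)%:P) :> {poly C}.
  by rewrite scalerDr -[_ *: _%:P]mul_polyC -polyCM divff // addrC.
rewrite exprZn linearZ /= hornerZ mulf_neq0 ?expf_neq0 //.
have ha : 0 < 'Im a^-1.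
  rewrite ImV /a raddfN opprK divr_gt0 ?exprn_gt0 ?normr_gt0 //.
  have nr : n%:R^-1 \is @Num.real C by rewrite rpredV realn.
by rewrite /= (ImMr nr) mulr_gt0 // invr_gt0 ltr0n.
have [/stable1P|/eqP] := hT (proj2 (stable1P _) (nonvanishing_exp_shift n ha)).
  exact.
by rewrite (negPf (hN _ _ Nn ha)).
Qed.

End Preserver.

(** * Geometric bounds on the symbol coefficients *)

Section SymbolBound.
Variable R : realType.
Local Notation C := R[i].
Implicit Types (z w v : C) (f g p q : {poly C}).
Variable T : {linear {poly C} -> {poly C}}.
Hypothesis hT : forall f, stable1 f -> stable1 (T f) \/ T f = 0.

Lemma nonvanishing_TXn k : T 'X^k != 0 -> nonvanishing (T 'X^k).
Proof.
move=> Tk; have hX : stable1 ('X^k : {poly C}).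
  apply/stable1P => z hz; rewrite hornerXn expf_neq0 //.
  by apply: contraTneq hz => ->; rewrite raddf0 ltxx.
by have [/stable1P|/eqP] := hT hX; last rewrite (negPf Tk).
Qed.

Lemma norm_symbol_coef z k : `|symbol_coef T z k| = `|(T 'X^k).[z]| / k`!%:R.
Proof.
by rewrite /symbol_coef !normrM normrX normrN1 expr1n mul1r normfV normr_nat.
Qed.

Lemma symbol_coef_mono z z' k : 'Re z' = 'Re z -> `|'Im z'| <= 'Im z ->
  `|symbol_coef T z' k| <= `|symbol_coef T z k|.
Proof.
move=> hre him; rewrite !norm_symbol_coef ler_wpM2r ?invr_ge0 ?ler0n //.
have [->|Tk] := eqVneq (T 'X^k) 0; first by rewrite !horner0 normr0.
by apply: nonvanishing_mono => //; apply: nonvanishing_TXn.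
Qed.

Lemma symbol_coef_disk_bound (r : C) k : 0 <= r ->
  exists2 U : C, 0 <= U & forall z, `|z| <= r -> `|symbol_coef T z k| <= U.
Proof.
move=> r0; exists ((\sum_(i < size (T 'X^k)) `|(T 'X^k)`_i| * r ^+ i) / k`!%:R).
  by rewrite divr_ge0 ?ler0n ?sumr_ge0 // => i _; rewrite mulr_ge0 ?exprn_ge0.
move=> z hz; rewrite norm_symbol_coef ler_wpM2r ?invr_ge0 ?ler0n //.
exact: norm_horner_le.
Qed.

Section NonDegenerate.
Variable N : nat.
Hypothesis hN : forall n v, (N <= n)%N -> 0 < 'Im v ->
  T (('X + v%:P) ^+ n) != 0.

(* Szasz' inequality applied, on the line [Im z = r], to the approximants divided by the
   power [w^m] of [w] that they contain: dividing is legitimate because [T 'X^m], their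
   lowest coefficient, is itself stable. *)
Lemma symbol_coef_geometric (r : C) : 0 < r -> exists2 K : C, 0 <= K &
  forall z, `|z| <= r -> forall k, `|symbol_coef T z k| * r ^+ k <= K.
Proof.
move=> r0; have [[m0 Tm0]|T0] := pselect (exists m, T 'X^m != 0); last first.
  exists 0 => // z _ k; rewrite norm_symbol_coef.
  have -> : T 'X^k = 0 by apply/eqP/negPn/negP => h; apply: T0; exists k.
  by rewrite horner0 normr0 !mul0r.
have [m Tm Tmin] : exists2 m, T 'X^m != 0 & forall k, (k < m)%N -> T 'X^k = 0.
  have exT : exists m, T 'X^m != 0 by exists m0.
  case: (ex_minnP exT) => m Tm hmin; exists m => // k hk.
  by apply/eqP/negPn/negP => /hmin; rewrite leqNgt hk.
have r2 : 0 <= 2 * r by rewrite mulr_ge0 ?ler0n ?ltW.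
(* A lower bound for [T 'X^m] along the whole line makes the ratios required by [szasz] uniform in
   [z]. *)
have [d d0 hd] := nonvanishing_lower_bound (nonvanishing_TXn Tm) r0.
have [U0 U00 hU0] := symbol_coef_disk_bound m r2.
have [U1 U10 hU1] := symbol_coef_disk_bound m.+1 r2.
have [U2 U20 hU2] := symbol_coef_disk_bound m.+2 r2.
have fm : 0 < m`!%:R :> C by rewrite ltr0n fact_gt0.
pose d' := d / m`!%:R; have d'0 : 0 < d' by rewrite divr_gt0.
have [B B0 hB] := @szasz R (U1 / d') (U2 / d') r (ltW r0).
(* The 2 compensates a weight of at least 1/2, [U0] bounds the lowest coefficient, and [r ^+ m]
   restores the power divided out. *)
exists (2 * (B * U0) * r ^+ m).
  by rewrite !mulr_ge0 ?ler0n ?exprn_ge0 ?(ltW r0).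
(* Moving [z0] vertically to the line [Im z = r] can only increase the coefficient moduli, and stays
   in the disk of radius [2 r]. *)
move=> z0 hz0 k; pose z := 'Re z0 + 'i * r.
have rr : r \is Num.real by rewrite gtr0_real.
have hre : 'Re z = 'Re z0 by rewrite /z Re_rect ?Creal_Re.
have him : 'Im z = r by rewrite /z Im_rect ?Creal_Re.
have hz : `|z| <= 2 * r.
  rewrite /z (le_trans (ler_normD _ _)) // normrM normCi mul1r gtr0_norm //.
  rewrite [2 * r]mulr_natl mulr2n lerD2r (le_trans _ hz0) //.
  exact: (leif_normC_Re_Creal _).1.
have hz0z : `|symbol_coef T z0 k| <= `|symbol_coef T z k|.
  apply: symbol_coef_mono => //; rewrite him (le_trans _ hz0) //.
  have := (leif_normC_Re_Creal ('i * z0)).1.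
  by rewrite ReMil normrN normrM normCi mul1r.
apply: le_trans (ler_wpM2r (exprn_ge0 _ (ltW r0)) hz0z) _.
have [km|mk] := ltnP k m.
  rewrite norm_symbol_coef (Tmin _ km) horner0 normr0 !mul0r.
  by rewrite !mulr_ge0 ?ler0n ?exprn_ge0 ?(ltW r0).
(* [n] may depend on [k] because the bound from [szasz] does not involve [n]; [2 ^ k.+1 <= n] makes
   the weight of index [k] at least 1/2. *)
have [n [Nn mn kn kn2]] : exists n, [/\ N <= n, m + 2 <= n, k < n & 2 ^ k.+1 <= n]%N.
  exists (2 ^ k.+1 + (N + (m + 2)))%N; split.
  - by rewrite addnCA leq_addr.
  - by rewrite addnA leq_addl.
  - by apply: leq_trans (leq_addr _ _); apply: ltnW; apply: ltn_expl.
  - exact: leq_addr.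
have n0 : (0 < n)%N by apply: leq_trans kn.
have m1n : (m + 1 <= n)%N by apply: leq_trans mn; rewrite leq_add2l.
have m0n : (m <= n)%N by apply: leq_trans mn; apply: leq_addr.
pose c := binomial_weight R n; pose b := symbol_coef T z.
have c_half : 2^-1 <= c k.
  have := binomial_weight_sub1 R k n0; rewrite -/(c k) lerBlDr -lerBlDl.
  apply: le_trans; rewrite [X in _ <= X - _](splitr 1) mul1r -addrA lerDl subr_ge0.
  by rewrite ler_pdivrMr ?ltr0n // mulrC ler_pdivlMr ?ltr0n // mulrC -exprS -natrX ler_nat.
pose h := \poly_(j < n.+1 - m) (c (m + j)%N * b (m + j)%N).
have hX : h * 'X^m = eval_inner z (approximant T n).
  apply/polyP => j; rewrite eval_inner_approximant coefMXn !coef_poly.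
  have [jm|mj] := ltnP j m.
    rewrite /symbol_coef (Tmin _ jm) horner0 mulr0 mul0r mulr0; by case: ifP.
  by rewrite ltn_subRL !subnKC.
have hcoef j : (m + j <= n)%N -> h`_j = c (m + j)%N * b (m + j)%N.
  by move=> hj; rewrite coef_poly ltn_subRL ltnS hj.
have c0 j : 0 <= c j by apply: binomial_weight_ge0.
have hh : nonvanishing h.
  move=> w hw; have zU : 0 < 'Im z by rewrite him.
  have := approximant_neq0 hT hN n0 Nn zU hw.
  rewrite -[eval2 _ _ _]/((eval_inner z (approximant T n)).[w]) -hX hornerM.
  by rewrite mulf_eq0 negb_or => /andP[].
have bm : d' <= `|b m|.
  by rewrite /b /d' norm_symbol_coef ler_wpM2r ?invr_ge0 ?(ltW fm) ?hd.
have h0E : `|h`_0| = c m * `|b m|.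
  by rewrite hcoef addn0 // normrM ger0_norm.
have cm0 : 0 < c m by apply: binomial_weight_gt0.
have bnd U j : 0 <= U -> `|b j| <= U -> c j <= c m -> c j * `|b j| <= U / d' * (c m * `|b m|).
  move=> hU hbj hcj; rewrite mulrCA ler_pM // (le_trans hbj) //.
  by rewrite mulrAC ler_pdivlMr // ler_wpM2l.
have h1 : `|h`_1| <= U1 / d' * `|h`_0|.
  rewrite h0E hcoef // addn1 normrM (ger0_norm (c0 _)).
  by apply: bnd => //; [apply: hU1 | apply: binomial_weight_leS].
have h2 : `|h`_2| <= U2 / d' * `|h`_0|.
  rewrite h0E hcoef // addn2 normrM (ger0_norm (c0 _)).
  apply: bnd => //; first exact: hU2.
  by apply: le_trans (binomial_weight_leS _ _ n0) (binomial_weight_leS _ _ n0).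
have h00 : h`_0 != 0.
  by rewrite -normr_gt0 h0E mulr_gt0 // (lt_le_trans d'0).
have := hB h hh h00 h1 h2 (k - m)%N.
have := hcoef (k - m)%N; rewrite (subnKC mk) => ->; last exact: ltnW.
rewrite normrM (ger0_norm (c0 _)) => hk.
have -> : r ^+ k = r ^+ (k - m) * r ^+ m by rewrite -exprD subnK.
rewrite [X in X <= _]mulrA ler_wpM2r ?exprn_ge0 ?(ltW r0) //.
rewrite -ler_pdivrMl ?ltr0n // mulrA.
apply: le_trans (le_trans hk _).
  by rewrite ler_wpM2r ?exprn_ge0 ?(ltW r0) // ler_wpM2r.
rewrite ler_wpM2l // h0E -[leRHS]mul1r ler_pM ?hU0 //.
exact: binomial_weight_le1.
Qed.
End NonDegenerate.
End SymbolBound.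

(** * Locally uniform convergence of the approximants to the symbol *)

Section SymbolConvergence.
Variable R : realType.
Local Notation C := R[i].
Implicit Types (z w v : C).
Variable T : {linear {poly C} -> {poly C}}.
Hypothesis hT : forall f, stable1 f -> stable1 (T f) \/ T f = 0.
Variable N : nat.
Hypothesis hN : forall n v, (N <= n)%N -> 0 < 'Im v ->
  T (('X + v%:P) ^+ n) != 0.

(** The radius [4 r] leaves two factors [2^-k]: one cancels the [2^k] of [binomial_weight_sub1], the
    other sums the series. *)
Lemma symbol_term_bound (r : C) : 0 < r -> exists2 K : C, 0 <= K &
  forall z w k, `|z| <= r -> `|w| <= r ->
    `|symbol_coef T z k * w ^+ k| <= K / 2 ^+ k / 2 ^+ k.
Proof.
move=> r0; have r4 : 0 < 4 * r by rewrite mulr_gt0 ?ltr0n.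
have [K K0 hK] := symbol_coef_geometric hT hN r4; exists K => // z w k hz hw.
have h2 : 0 < 2 ^+ k :> C by rewrite exprn_gt0 ?ltr0n.
rewrite !ler_pdivlMr //; apply: le_trans (hK z _ k); last first.
  by rewrite (le_trans hz) // ler_peMl ?(ltW r0) // ler1n.
rewrite normrM normrX -!mulrA ler_wpM2l // -!exprMn.
rewrite lerXn2r ?nnegrE ?mulr_ge0 ?ler0n ?(ltW r0) //.
by rewrite mulrC -natrM ler_wpM2l ?ler0n.
Qed.

Lemma GT_partial_cauchy (r : C) : 0 < r -> exists2 K : C, 0 <= K &
  forall z w n n', `|z| <= r -> `|w| <= r -> (n <= n')%N ->
    `|GT_partial T n' z w - GT_partial T n z w| <= K / 2 ^+ n.
Proof.
move=> r0; have [K K0 hK] := symbol_term_bound r0.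
exists (2 * K); first by rewrite mulr_ge0 ?ler0n.
move=> z w n n' hz hw hn; rewrite !GT_partialE.
apply: (@geometric_tail _ (fun k => symbol_coef T z k * w ^+ k)) => // k.
apply: le_trans (hK _ _ k hz hw) _; rewrite ler_pdivrMr ?exprn_gt0 ?ltr0n //.
by rewrite ler_peMr ?divr_ge0 ?exprn_ge0 ?ler0n // exprn_ege1 // ler1n.
Qed.

Lemma GT_partial_cvg z w : exists l : C, forall e : C, 0 < e -> exists n0 : nat,
  forall n, (n0 <= n)%N -> `|GT_partial T n z w - l| < e.
Proof.
have r0 : 0 < `|z| + `|w| + 1 by rewrite ltr_wpDl ?addr_ge0 ?ltr01.
have [K K0 hK] := GT_partial_cauchy r0.
have dE n : (complex.Re (K / 2 ^+ n))%:C%C = K / 2 ^+ n.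
  by rewrite RRe_real // ger0_real // divr_ge0 ?exprn_ge0 ?ler0n.
have hz : `|z| <= `|z| + `|w| + 1 by rewrite -addrA lerDl addr_ge0 ?ler01.
have hw : `|w| <= `|z| + `|w| + 1 by rewrite addrAC lerDr addr_ge0 ?ler01.
have [n n' hn|l hl] := @cauchy_limit _ (fun n => GT_partial T n z w)
    (fun n => complex.Re (K / 2 ^+ n)).
  by rewrite dE; apply: hK.
exists l => e e0; have e2 : 0 < e / 2 by rewrite divr_gt0 ?ltr0n.
have [n0 hn0] := @exists_div_exp2_le _ (2 * K) _ (mulr_ge0 (ler0n _ 2) K0) e2.
exists n0 => n hn; apply: le_lt_trans (hl n) _; rewrite dE mulrA.
apply: le_lt_trans (hn0 n hn) _.
by rewrite ltr_pdivrMr ?ltr0n // ltr_pMr // ltr1n.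
Qed.

Lemma approximant_close (r : C) : 0 < r -> exists2 K : C, 0 <= K &
  forall z w n, `|z| <= r -> `|w| <= r -> (0 < n)%N ->
    `|eval2 (approximant T n) z w - GT_partial T n.+1 z w| <= K / n%:R.
Proof.
move=> r0; have [K K0 hK] := symbol_term_bound r0.
exists (2 * K); first by rewrite mulr_ge0 ?ler0n.
move=> z w n hz hw n0; rewrite eval2_approximant GT_partialE -sumrB.
have n0' : 0 < n%:R :> C by rewrite ltr0n.
apply: (@le_trans _ _ (`|\sum_(k < n.+1) K / n%:R / 2 ^+ k - \sum_(k < 0) K / n%:R / 2 ^+ k|)).
  rewrite big_ord0 subr0 [leRHS]ger0_norm; last first.
    by apply: sumr_ge0 => k _; rewrite !divr_ge0 ?exprn_ge0 ?ler0n.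
  apply: le_trans (ler_norm_sum _ _ _) _; apply: ler_sum => k _.
  rewrite -{2}[symbol_coef T z k * _]mul1r -mulrBl normrM distrC.
  rewrite [`|1 - _|]ger0_norm ?subr_ge0 ?binomial_weight_le1 //.
  apply: le_trans (ler_pM _ _ (binomial_weight_sub1 R k n0) (hK _ _ k hz hw)) _ => //.
    by rewrite subr_ge0 binomial_weight_le1.
  rewrite le_eqVlt; apply/orP; left; apply/eqP; field.
  by rewrite expf_neq0 ?pnatr_eq0 // gt_eqF.
apply: le_trans (@geometric_tail _ (fun k => K / n%:R / 2 ^+ k) (K / n%:R) _ _ _ (leq0n _)) _.
  by move=> k; rewrite ger0_norm // !divr_ge0 ?exprn_ge0 ?ler0n.
by rewrite expr0 divr1 mulrA.
Qed.

Lemma nondegenerate_closure : GT_in_closure_H2 T.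
Proof.
have [F hF] : exists F : C -> C -> C, forall z w e, 0 < e -> exists n0 : nat,
    forall n, (n0 <= n)%N -> `|GT_partial T n z w - F z w| < e.
  exists (fun z w => projT1 (cid (GT_partial_cvg z w))) => z w.
  exact: (projT2 (cid (GT_partial_cvg z w))).
(* The shift by [N] and the successor ensure an index that is positive and at least [N], as
   stability of the approximant requires. *)
exists F; split=> //; exists (fun n => approximant T (N + n).+1); split=> [n|r e r0 e0].
  have h := @approximant_neq0 _ T hT N hN (N + n).+1 (ltn0Sn _) (leqW (leq_addr _ _)).
  split=> //; apply: contraTneq isT => P0.
  have := h 'i 'i (Im_gt0_i _) (Im_gt0_i _).
  by rewrite P0 /eval2 map_poly0 horner0 eqxx.
have [K K0 hK] := approximant_close r0.
have [L L0 hL] := GT_partial_cauchy r0.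
have [n0 hn0] := exists_ge_nat (divr_ge0 (addr_ge0 K0 L0) (ltW e0)).
exists n0 => n hn z w hz hw; set m := (N + n).+1.
have m0 : 0 < m%:R :> C by rewrite ltr0n.
(* The geometric rate is weakened to [L / m] so that it adds to the rate [K / m] of the
   approximants. *)
have hlim : `|GT_partial T m.+1 z w - F z w| <= L / m%:R.
  apply/ler_addgt0Pr => d d0; have [n1 hn1] := hF z w d d0.
  pose n' := maxn m.+1 n1.
  rewrite -(subrK (GT_partial T n' z w) (GT_partial T m.+1 z w)) -addrA.
  apply: le_trans (ler_normD _ _) _; apply: lerD; last by rewrite ltW // hn1 // leq_maxr.
  rewrite distrC; apply: le_trans (hL _ _ _ _ hz hw (leq_maxl _ _)) _.
  rewrite ler_wpM2l // lef_pV2 ?posrE ?exprn_gt0 ?ltr0n // -natrX ler_nat.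
  by apply: ltnW; apply: leq_trans (ltn_expl m.+1 _).
rewrite -(subrK (GT_partial T m.+1 z w) (eval2 _ z w)) -addrA.
apply: le_lt_trans (ler_normD _ _) _.
apply: le_lt_trans (lerD (hK z w m hz hw isT) hlim) _.
rewrite -mulrDl ltr_pdivrMr // mulrC -ltr_pdivrMr // (le_lt_trans hn0) // ltr_nat.
by rewrite /m ltnS (leq_trans hn) // leq_addl.
Qed.
End SymbolConvergence.

Unset Implicit Arguments.

Theorem mainTheorem7 (R : realType) (T : {linear {poly R[i]} -> {poly R[i]}}) :
  (forall f : {poly R[i]}, stable1 f -> stable1 (T f) \/ T f = 0)
  <->
  ((exists (alpha : {linear {poly R[i]} -> R[i]^o}) (P : {poly R[i]}),
       stable1 P /\ forall f : {poly R[i]}, T f = alpha f *: P)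
   \/ GT_in_closure_H2 T).
Proof.
split=> [hT|[[alpha [P [/stable1P hP TE]]]|[F [[Ps [hPs hcvg]] hGT]]] f hf].
(* Either [T] kills powers [(X + v)^n] with [Im v > 0] for unboundedly many [n], or it kills none
   from some [N] on. *)
- have [h|h] := pselect (forall N, exists n v,
      [/\ (N <= n)%N, 0 < 'Im v & T (('X + v%:P) ^+ n) = 0]).
    by left; apply: rank_le1; apply: degenerate_rank_le1.
  right; have /existsNP[N hN] := h; apply: (@nondegenerate_closure _ _ hT N) => n v Nn hv.
  by apply/eqP => T0; apply: hN; exists n, v.
- rewrite TE; have [->|a0] := eqVneq (alpha f) 0; first by right; rewrite scale0r.
  by left; apply/stable1P => z hz; rewrite hornerZ mulf_neq0 ?hP.
- exact (@GT_preserves _ T F Ps hPs hcvg hGT f hf).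
Qed.
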